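(* Let $\mathcal{S}$ be a semi-ring of subsets of a set $\Omega$ and let $F=(\nu_j)_{j\in J}\subseteq c(\mathcal{S})$ be a family of signed charges such that $\sup_{j\in J}\nu_j(A)>-\infty$ for all $A\in\mathcal{S}$. Suppose each $\nu_j$ is countably sub-additive, and there is a finite measure $\lambda$ on $\mathcal{S}$ such that $\mu_F\ge-\lambda$, where $$\mu_F(A):=\sup_{\Pi\in\mathscr{P}(A)}\ \sum_{C\in\Pi}\ \sup_{j\in J}\nu_j(C),\qquad A\in\mathcal{S}.$$ Then $\mu_F$ is a signed measure.
   Context: A semi-ring $\mathcal{S}$ of subsets of $\Omega$ is a family with $\emptyset\in\mathcal{S}$, closed under finite intersections, and such that for $A,B\in\mathcal{S}$ the set $A\setminus B$ is a finite disjoint union of elements of $\mathcal{S}$. $\mathscr{P}(A)$ denotes the family of all finite partitions of $A$ by (pairwise disjoint) elements of $\mathcal{S}$. A signed charge on $\mathcal{S}$ is a set function $\mu:\mathcal{S}\to\overline{\mathbb{R}}=[-\infty,\infty]$ with $\mu(\emptyset)=0$ that avoids at least one of the values $+\infty,-\infty$ and is finitely additive (for finite families of pairwise disjoint elements of $\mathcal{S}$ whose union is in $\mathcal{S}$). $c(\mathcal{S})$ is the set of all signed charges on $\mathcal{S}$. A signed measure is a countably additive signed charge, i.e. $\mu(\bigcup_n A_n)=\sum_n\mu(A_n)$ for every sequence of pairwise disjoint elements of $\mathcal{S}$ with union in $\mathcal{S}$. A measure is a non-negative signed measure; finite means taking only finite values. A set function $\mu$ is countably sub-additive if for every sequence $(A_n)$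 of pairwise disjoint elements of $\mathcal{S}$ whose union is in $\mathcal{S}$, the sum $\sum_n\mu(A_n)$ is well defined in $\overline{\mathbb{R}}$ (the sums of the positive parts and of the negative parts are not both infinite) and $\mu(\bigcup_n A_n)\le\sum_n\mu(A_n)$. Inequalities between set functions are understood pointwise on $\mathcal{S}$. *)

(* Defs.v *)
From HB Require Import structures.
From mathcomp Require Import all_boot all_order all_algebra.
From mathcomp Require Import all_classical all_reals all_analysis.

Set Implicit Arguments.
Unset Strict Implicit.
Unset Printing Implicit Defensive.

Import Order.TTheory GRing.Theory Num.Theory.

Local Open Scope classical_set_scope.
Local Open Scope ring_scope.
Local Open Scope ereal_scope.

(* The semi-ring is [measurable : set (set T)]. As usual in MathComp-Analysis,
   set functions are total on [set T], but every definition below only depends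
   on their values on the semi-ring. *)

(* The library's charges are finite-valued; these may take one of the two
   infinite values. *)
Definition signed_charge d (T : semiRingOfSetsType d) (R : realType)
    (mu : set T -> \bar R) : Prop :=
  [/\ mu set0 = 0,
      (forall A, measurable A -> mu A != +oo) \/
      (forall A, measurable A -> mu A != -oo)
    & measure_function.semi_additive mu].

Definition signed_measure d (T : semiRingOfSetsType d) (R : realType)
    (mu : set T -> \bar R) : Prop :=
  signed_charge mu /\ semi_sigma_additive mu.

Definition well_defined_series (R : realType) (u : nat -> \bar R) : Prop :=
  ~ (\sum_(n <oo) u^\+ n = +oo /\ \sum_(n <oo) u^\- n = +oo).

(* [\sum_(n <oo) _] is the limit of the partial sums; it exists whenever the
   series is well defined, and is then the difference of the two sums above. *)
Definition countably_subadditive d (T : semiRingOfSetsType d) (R : realType)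
    (mu : set T -> \bar R) : Prop :=
  forall A : nat -> set T, (forall n, measurable (A n)) -> trivIset setT A ->
    measurable (\bigcup_n A n) ->
    well_defined_series (fun n => mu (A n)) /\
    mu (\bigcup_n A n) <= \sum_(n <oo) mu (A n).

(* The blocks of a [partition] are nonempty. *)
Definition finite_partitions d (T : semiRingOfSetsType d) (A : set T) :
    set (set (set T)) :=
  [set Pi | [/\ finite_set Pi, Pi `<=` measurable & partition Pi id A]].

Definition sup_family d (T : semiRingOfSetsType d) (R : realType) (J : Type)
    (nu : J -> set T -> \bar R) (A : set T) : \bar R :=
  ereal_sup (range (fun j => nu j A)).

Definition mu_family d (T : semiRingOfSetsType d) (R : realType) (J : Type)
    (nu : J -> set T -> \bar R) (A : set T) : \bar R :=
  ereal_sup [set \sum_(C \in Pi) sup_family nu C | Pi in finite_partitions A].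

(* Main.v *)
Require Import Defs.
From HB Require Import structures.
From mathcomp Require Import all_boot all_order all_algebra.
From mathcomp Require finmap.
From mathcomp Require Import all_classical all_reals all_analysis.

(** Write [s] for the pointwise supremum of the family, [mu] for the supremum
of the sums of [s] over finite partitions, and [m = mu + lambda], which is
nonnegative since [lambda] is a finite measure dominating [- mu].  As [lambda]
is finite and countably additive, it is enough to show that
[m (\bigcup_i F i) = \sum_i m (F i)] for disjoint [F i] whose union [A] is
measurable; both sides are then sums of nonnegative terms, so every convergence
and exchange of sums is unconditional.  Finite additivity of [mu] follows from
the countable one.

Lower bound for [m A].  The defining formula of [mu] makes sense for every
subset, and there it is superadditive on disjoint sets, because the union of
partitions of two disjoint sets is a partition of their union
([mu_family_superadditive]).  Cutting [A] into [F 0], ..., [F n.-1] and a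
remainder gives [m A >= \sum_(i < n) m (F i)], provided that [m] is nonnegative
on the remainder.  The remainder is not in the semi-ring in general, but it is
in the ring generated by it, hence a finite disjoint union of elements of the
semi-ring, and superadditivity reduces the claim to these
([shifted_mu_family_ring_ge0]).

Upper bound for [m A].  Countable subadditivity of each member of the family
gives [s C <= \sum_i mu (C `&` F i)] for every block [C] of a partition of [A],
hence [s C + lambda C <= \sum_i m (C `&` F i)]
([sup_family_le_shifted_series]).  Summing over the blocks, exchanging the two
sums and using superadditivity of [m] on each [F i] yields
[mu A + lambda A <= \sum_i m (F i)] ([shifted_mu_family_le_series]). *)

Local Open Scope classical_set_scope.
Local Open Scope ring_scope.
Local Open Scope ereal_scope.
Set Implicit Arguments.
Unset Strict Implicit.
Unset Printing Implicit Defensive.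
Import Order.TTheory GRing.Theory Num.Theory.

(** An empty or infinite supremum causes no trouble: in the extended reals
[-oo] absorbs [+oo], so the left-hand side is [-oo] unless both sets contain
elements above [-oo]; these then bound each other when [z] is finite. *)
Lemma ereal_supD_le (R : realType) (X Y : set (\bar R)) (z : \bar R) :
  (forall x y, X x -> Y y -> x + y <= z) -> ereal_sup X + ereal_sup Y <= z.
Proof.
move=> XYz.
have [->|] := eqVneq (ereal_sup X) -oo; first by rewrite leNye.
rewrite -ltNye => /ereal_sup_gt[x0 Xx0 x0Ny].
have [->|] := eqVneq (ereal_sup Y) -oo; first by rewrite addeNy leNye.
rewrite -ltNye => /ereal_sup_gt[y0 Yy0 y0Ny].
have := XYz _ _ Xx0 Yy0; case: z XYz => [z XYz|_ _|]; last 2 first.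
- by rewrite leey.
- by move=> _; rewrite leeNy_eq adde_eq_ninfty => /orP[]/eqP h;
    rewrite h ltxx in x0Ny y0Ny.
have fin x y : X x -> Y y -> -oo < x -> -oo < y -> x \is a fin_num.
  move=> Xx Yy; have := XYz _ _ Xx Yy.
  by case: x {Xx} => [//|/=|]; case: y {Yy}.
move=> _.
have supY x : X x -> -oo < x -> ereal_sup Y <= z%:E - x.
  move=> Xx xNy; have xfin := fin _ _ Xx Yy0 xNy y0Ny.
  apply: ge_ereal_sup => y Yy; rewrite leeBrDr// addeC; exact: XYz.
have x0fin := fin _ _ Xx0 Yy0 x0Ny y0Ny.
have supYfin : ereal_sup Y \is a fin_num.
  rewrite fin_numE -ltNye (lt_le_trans y0Ny) ?ereal_sup_ubound//=.
  rewrite -ltey (le_lt_trans (supY _ Xx0 x0Ny))//.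
  by rewrite ltey_eq fin_numB x0fin.
rewrite -leeBrDr//; apply: ge_ereal_sup => x Xx.
have [->|] := eqVneq x -oo; first by rewrite leNye.
rewrite -ltNye => xNy; have xfin := fin _ _ Xx Yy0 xNy y0Ny.
by rewrite leeBrDr// addeC -leeBrDr// supY.
Qed.

(** * Superadditivity on arbitrary sets *)

Section partition_supremum.
Context {d : measure_display} {T : semiRingOfSetsType d} {R : realType}.
Context {J : Type} (nu : J -> set T -> \bar R).

(** Blocks being nonempty, the only partition of [set0] is the empty one. *)
Lemma mu_family0 : mu_family nu set0 = 0.
Proof.
rewrite /mu_family (_ : [set _ | _ in _] = [set 0]) ?ereal_sup1//.
apply/seteqP; split => [_ [Pi [finPi mPi [covPi tPi Pi0]] <-]|_ ->].
  rewrite fsbig1// => C PiC; have [x Cx] := Pi0 _ PiC.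
  by have : set0 x by rewrite -covPi; exists C.
exists set0; last by rewrite fsbig_set0.
by split => //; split => //; rewrite /cover bigcup_set0.
Qed.

(** No measurability is assumed: a set without any finite partition gets the
value [-oo].  This matters because differences of elements of a semi-ring may
leave it. *)
Lemma mu_family_superadditive2 (A B : set T) : A `&` B = set0 ->
  mu_family nu A + mu_family nu B <= mu_family nu (A `|` B).
Proof.
move=> AB0; apply: ereal_supD_le => _ _ [PA [finA mA [covA tA neA]] <-]
  [PB [finB mB [covB tB neB]] <-].
have disj C D : PA C -> PB D -> ~ (C `&` D !=set0).
  move=> PAC PBD [x [Cx Dx]].
  suff : set0 x by [].
  by rewrite -AB0; split; rewrite -?covA -?covB; [exists C|exists D].
rewrite -fsbigU0//; last first.
  move=> C [PAC PBC]; have [x Cx] := neA _ PAC.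
  by have [] := disj C C PAC PBC; exists x.
apply: ereal_sup_ubound; exists (PA `|` PB) => //; split.
- by rewrite finite_setU.
- by move=> C [/mA|/mB].
- split; first by rewrite /cover bigcup_setU -covA -covB.
  + move=> C D [PC|PC] [PD|PD] /= CD; [exact: tA| | |exact: tB].
    * by have := disj _ _ PC PD CD.
    * by rewrite setIC in CD; have := disj _ _ PD PC CD.
  + by move=> C [/neA|/neB].
Qed.

Lemma mu_family_superadditive (I : choiceType) (D : set I) (F : I -> set T) :
  finite_set D -> trivIset D F ->
  \sum_(i \in D) mu_family nu (F i) <= mu_family nu (\bigcup_(i in D) F i).
Proof.
move=> finD tF.
suff seq_le (r : seq I) : uniq r -> trivIset [set` r] F ->
    \sum_(i <- r) mu_family nu (F i) <=
    mu_family nu (\bigcup_(i in [set` r]) F i).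
  rewrite fsbig_finite// -[in leRHS](fset_setK finD).
  by apply: seq_le; [exact: finmap.fset_uniq|rewrite fset_setK].
elim: r => [|i r IHr] /= {tF}.
  move=> _ _; rewrite big_nil (_ : [set` [::]] = set0).
    by rewrite bigcup_set0 mu_family0.
  by apply/seteqP; split.
move=> /andP[ir ur] tF; rewrite big_cons.
rewrite (_ : [set` i :: r] = i |` [set` r]); last first.
  by apply/seteqP; split=> k /=; rewrite inE => /predU1P.
rewrite bigcup_setU1; apply: le_trans (mu_family_superadditive2 _).
  rewrite leeD2l// IHr//; apply: sub_trivIset tF => k /= kr.
  by rewrite inE kr orbT.
apply/seteqP; split => // x [Fix [k /= kr Fkx]].
have ik : i = k.
  by apply: tF; rewrite /= ?inE ?eqxx ?kr ?orbT//; exists x.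
by move: ir; rewrite ik kr.
Qed.

(** The one-block partition of [A], which is not a legal one when [A] is empty:
hence the assumption on [set0]. *)
Lemma sup_family_le_mu_family (A : set T) : (forall j, nu j set0 = 0) ->
  measurable A -> sup_family nu A <= mu_family nu A.
Proof.
move=> nu0 mA; have [->|/set0P A0] := eqVneq A set0.
  by rewrite mu_family0; apply: ge_ereal_sup => _ [j _ <-]; rewrite nu0.
apply: ereal_sup_ubound; exists [set A]; last by rewrite fsbig_set1.
split => //; first by move=> _ ->.
by split; [rewrite /cover bigcup_set1|move=> ? ? -> ->|move=> _ ->].
Qed.

End partition_supremum.

(** * Countable additivity under domination by a finite measure *)

Section domination.
Context {d : measure_display} {T : semiRingOfSetsType d} {R : realType}.
Context {J : Type} (nu : J -> set T -> \bar R).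
Context (lambda : {measure set T -> \bar R}).
Context (lambda_fin : fin_num_fun lambda).
Context (mu_ge : forall A, measurable A -> - lambda A <= mu_family nu A).

Lemma shifted_mu_family_ge0 (A : set T) : measurable A ->
  0 <= mu_family nu A + lambda A.
Proof. by move=> mA; rewrite -leeBlDr ?sub0e ?lambda_fin ?mu_ge. Qed.

(** The lower bound on [mu_family nu] passes from the semi-ring to the generated
ring: superadditivity bounds the value at [X] below by the sum over the pieces
of [X], while the extension of [lambda] is that sum exactly. *)
Lemma shifted_mu_family_ring_ge0 (X : set (SetRing.type T)) : measurable X ->
  0 <= mu_family nu X + SetRing.measure lambda X.
Proof.
move=> mX; have finX := SetRing.decomp_finite_set X.
have := mu_family_superadditive nu finX (SetRing.decomp_triv (A := X)).
rewrite (SetRing.cover_decomp X) => muX.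
apply: le_trans (leeD2r _ muX).
rewrite /SetRing.measure -fsbig_split//= fsume_ge0// => C XC.
apply: shifted_mu_family_ge0; apply: SetRing.decomp_measurable mX _.
by rewrite inE.
Qed.

(** Superadditivity applied to the [F i] and to what remains of [A], the
remainder having a nonnegative contribution. *)
Lemma shifted_mu_family_sum_le (A : set T) (F : nat -> set T) (n : nat) :
  measurable A -> (forall i, measurable (F i)) -> trivIset setT F ->
  (forall i, F i `<=` A) ->
  \sum_(0 <= i < n) (mu_family nu (F i) + lambda (F i)) <=
    mu_family nu A + lambda A.
Proof.
move=> mA mF tF FA; have tFn : trivIset `I_n F by apply: sub_trivIset tF.
set U : set (SetRing.type T) := \bigcup_(i in `I_n) F i.
have rmA : measurable (A : set (SetRing.type T)).
  exact: SetRing.measurable_subring.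
have mU : measurable U.
  apply: fin_bigcup_measurable => // i _.
  exact: SetRing.measurable_subring.
have UA : A = U `|` (A `\` U) :> set T.
  by rewrite setDUK//; apply: bigcup_sub => i _.
have AU : measurable ((A : set (SetRing.type T)) `\` U) by apply: measurableD.
have lambdaA : lambda A = \sum_(i \in `I_n) lambda (F i) +
    SetRing.measure lambda (A `\` U).
  rewrite -SetRing.RmuE// UA measureU//; last by rewrite setDIK.
  congr (_ + _); last by rewrite -UA.
  exact: SetRing.Rmu_fin_bigcup.
rewrite big_mkord (fsbig_ord _ _ (fun i => mu_family nu (F i) + lambda (F i))).
rewrite fsbig_split//= lambdaA.
apply: (@le_trans _ _ (\sum_(i \in `I_n) mu_family nu (F i) +
    \sum_(i \in `I_n) lambda (F i) +
    (mu_family nu (A `\` U) + SetRing.measure lambda (A `\` U)))).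
  by rewrite leeDl// shifted_mu_family_ring_ge0.
rewrite addeACA leeD2r//.
rewrite [in leRHS]UA; apply: le_trans (mu_family_superadditive2 _ _).
  by rewrite leeD2r// mu_family_superadditive.
by rewrite setDIK.
Qed.

Context (nu0 : forall j, nu j set0 = 0).
Context (nu_subadd : forall j, countably_subadditive (nu j)).

(** Each term [nu j (F i)] is at most [mu_family nu (F i)]; adding the series of
[lambda] to countable subadditivity of [nu j] gives the bound.  Only a finite
right-hand side is of interest, and then the series of [nu j] converges, being
the sum of a convergent series and of a series of nonpositive terms. *)
Lemma sup_family_le_shifted_series (F : nat -> set T) :
  (forall i, measurable (F i)) -> trivIset setT F ->
  measurable (\bigcup_i F i) ->
  sup_family nu (\bigcup_i F i) + lambda (\bigcup_i F i) <=
    \sum_(i <oo) (mu_family nu (F i) + lambda (F i)).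
Proof.
move=> mF tF mUF.
set m : nat -> \bar R := fun i => mu_family nu (F i) + lambda (F i).
have m0 i : 0 <= m i by apply: shifted_mu_family_ge0.
have [->|] := eqVneq (\sum_(i <oo) m i) +oo; first by rewrite leey.
rewrite -ltey => mltoo.
have sum_m0 : 0 <= \sum_(i <oo) m i by apply: nneseries_ge0.
have sum_mfin : \sum_(i <oo) m i \is a fin_num by rewrite ge0_fin_numE.
have mfin i : m i \is a fin_num.
  rewrite ge0_fin_numE//; apply: le_lt_trans mltoo.
  by rewrite (nneseriesD1 (n := i))// leeDl// nneseries_ge0.
rewrite -leeBrDr ?lambda_fin//; apply: ge_ereal_sup => _ [j _ <-].
have nu_le i : nu j (F i) + lambda (F i) <= m i.
  rewrite leeD2r//; apply: le_trans (sup_family_le_mu_family nu0 (mF i)).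
  by apply: ereal_sup_ubound; exists j.
have nu_le' i : nu j (F i) <= m i.
  by apply: le_trans (nu_le i); rewrite leeDl.
have nuBm_le0 i : nu j (F i) - m i <= 0.
  by rewrite leeBlDr ?mfin// add0e.
have cvg_nu : cvg ((\sum_(0 <= i < n) nu j (F i)) @[n --> \oo]).
  apply/cvg_ex; exists (\sum_(i <oo) m i + \sum_(i <oo) (nu j (F i) - m i)).
  rewrite (_ : (fun n => _) = (fun n => \sum_(0 <= i < n) m i) \+
      (fun n => \sum_(0 <= i < n) (nu j (F i) - m i))).
    apply: cvgeD; first by rewrite fin_num_adde_defr.
    - exact: is_cvg_nneseries.
    - exact: is_cvg_npeseries.
  apply/funext => n /=; rewrite -big_split/=; apply: eq_bigr => i _.
  by rewrite addeC subeK.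
rewrite leeBrDr ?lambda_fin//.
have [_ nuUF] := nu_subadd j mF tF mUF.
apply: le_trans (leeD2r _ nuUF) _.
have cvg_sum := cvgeD (fin_num_adde_defl _ (lambda_fin mUF)) cvg_nu
  (measure_semi_sigma_additive _ mF tF mUF).
apply: (cvge_to_le (cvg_sum _)); apply: nearW => n /=.
rewrite -big_split/=; apply: (@le_trans _ _ (\sum_(0 <= i < n) m i)).
  by apply: lee_sum => i _.
exact: nneseries_lim_ge.
Qed.

(** Cut the blocks of a partition along the [F i]: the double series has
nonnegative terms and may be summed in the other order, where the pieces of
[F i] recombine by superadditivity. *)
Lemma shifted_mu_family_le_series (F : nat -> set T) :
  (forall i, measurable (F i)) -> trivIset setT F ->
  measurable (\bigcup_i F i) ->
  mu_family nu (\bigcup_i F i) + lambda (\bigcup_i F i) <=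
    \sum_(i <oo) (mu_family nu (F i) + lambda (F i)).
Proof.
move=> mF tF mUF; rewrite -leeBrDr ?lambda_fin//.
apply: ge_ereal_sup => _ [Pi [finPi mPi [covPi tPi _]] <-].
rewrite leeBrDr ?lambda_fin//.
(* [lambda] is spread over the blocks so that each of them is shifted. *)
have -> : lambda (\bigcup_i F i) = \sum_(C \in Pi) lambda C.
  by rewrite -[X in lambda X]covPi content_fin_bigcup// -/(cover Pi id) covPi.
rewrite -fsbig_split//=.
have mCF C i : Pi C -> measurable (C `&` F i).
  by move=> PiC; apply: measurableI => //; apply: mPi.
apply: (@le_trans _ _ (\sum_(C \in Pi) \sum_(i <oo)
    (mu_family nu (C `&` F i) + lambda (C `&` F i)))).
  apply: lee_fsum => // C PiC.
  have CF : C = \bigcup_i (C `&` F i).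
    rewrite -setI_bigcupr setIidl// -covPi; exact: bigcup_sup.
  rewrite {1 2}CF; apply: sup_family_le_shifted_series.
  - by move=> i; apply: mCF.
  - exact: trivIset_setIl.
  - by rewrite -CF; apply: mPi.
rewrite fsbig_finite// big_seq -nneseries_sum; last first.
  move=> C i; rewrite in_fset_set// inE => PiC.
  exact/shifted_mu_family_ge0/mCF.
apply: lee_nneseries => [i _ _|i _].
  rewrite sume_ge0// => C; rewrite in_fset_set// inE => PiC.
  exact/shifted_mu_family_ge0/mCF.
rewrite -big_seq -fsbig_finite// fsbig_split//=.
have tPiF : trivIset Pi (fun C => C `&` F i) by apply: trivIset_setIr.
have FPi : \bigcup_(C in Pi) (C `&` F i) = F i.
  rewrite -setI_bigcupl setIidr// -/(cover Pi id) covPi; exact: bigcup_sup.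
apply: leeD.
  by apply: le_trans (mu_family_superadditive _ finPi tPiF) _; rewrite FPi.
by rewrite -content_fin_bigcup// ?FPi// => C PiC; apply: mCF.
Qed.

(** The partial sums of [m] converge by monotonicity, to the common value of the
two bounds; subtracting the finite measure [lambda] gives back [mu_family]. *)
Lemma mu_family_semi_sigma_additive : semi_sigma_additive (mu_family nu).
Proof.
move=> F mF tF mUF.
set m : nat -> \bar R := fun i => mu_family nu (F i) + lambda (F i).
have m0 i : 0 <= m i by apply: shifted_mu_family_ge0.
have cvgm : (\sum_(0 <= i < n) m i) @[n --> \oo] -->
    mu_family nu (\bigcup_i F i) + lambda (\bigcup_i F i).
  rewrite (_ : _ + _ = \sum_(i <oo) m i); first exact: is_cvg_nneseries.
  apply/eqP; rewrite eq_le shifted_mu_family_le_series//=.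
  apply: lime_le; first exact: is_cvg_nneseries.
  apply: nearW => n; apply: shifted_mu_family_sum_le => // i x Fix.
  by exists i.
have lfin : - lambda (\bigcup_i F i) \is a fin_num.
  by rewrite fin_numN lambda_fin.
have cvgB := cvgeB (fin_num_adde_defl _ lfin) cvgm
  (measure_semi_sigma_additive _ mF tF mUF).
rewrite addeK ?lambda_fin// in cvgB.
apply: cvg_trans (cvgB _); apply: near_eq_cvg; apply: nearW => n /=.
rewrite big_split/= addeK//.
by rewrite sum_fin_num; apply/allP => _ /mapP[i _ ->]; apply: lambda_fin.
Qed.

End domination.

Theorem theorem3p3 (R : realType) (d : measure_display)
    (T : semiRingOfSetsType d) (J : Type) (nu : J -> set T -> \bar R)
    (nu_charge : forall j, signed_charge (nu j))
    (nu_sup : forall A, measurable A -> -oo < sup_family nu A)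
    (nu_subadd : forall j, countably_subadditive (nu j))
    (lambda : {measure set T -> \bar R})
    (lambda_fin : fin_num_fun lambda)
    (mu_ge : forall A, measurable A -> - lambda A <= mu_family nu A) :
  signed_measure (mu_family nu).
Proof.
have nu0 j : nu j set0 = 0 by case: (nu_charge j).
have mu_sigma := mu_family_semi_sigma_additive lambda_fin mu_ge nu0 nu_subadd.
split=> //; split.
- exact: mu_family0.
- right=> A mA; rewrite -ltNye; apply: (lt_le_trans _ (mu_ge _ mA)).
  by rewrite ltNye_eq fin_numN lambda_fin.
- exact: semi_sigma_additive_is_additive (mu_family0 nu) mu_sigma.
Qed.
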